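(* Let $n>1$, let $U\subset\mathbb{R}^n$ be a nonempty open set which is invariant under the action of the orthogonal group $O(n)$ (i.e. $x\in U$ and $|x'|=|x|$ imply $x'\in U$), set $I=\{|x|^2: x\in U\}\subset[0,+\infty)$, and let $\theta\colon I\to(0,+\infty)$ be a positive function of class $C^2$. Let $\Sigma=\{x+iy\in\mathbb{C}^n: x\in U,\ |y|^2=\theta(|x|^2)\}$. In the formulas below, $\theta,\theta',\theta''$ are evaluated at $|x|^2$. (1) The domain $D_-=\{x+iy\in\mathbb{C}^n: x\in U,\ |y|^2<\theta(|x|^2)\}$ is strongly pseudoconvex along $\Sigma$ if and only if, for all $x\in U$, $$\theta'<1,\qquad 2|x|^2\,\theta\,\theta''<(1-\theta')\left(|x|^2\theta'^2+\theta\right).$$ (2) The domain $D_+=\{x+iy\in\mathbb{C}^n: x\in U,\ |y|^2>\theta(|x|^2)\}$ is strongly pseudoconvex along $\Sigma$ if and only if the reverse inequalities hold, i.e. for all $x\in U$, $$\theta'>1,\qquad 2|x|^2\,\theta\,\theta''>(1-\theta')\left(|x|^2\theta'^2+\theta\right).$$ (3) Suppose $\theta$ solves the differential equation $$2|x|^2\,\theta\,\theta''=(1-\theta')\left(|x|^2\theta'^2+\theta\right)\qquad(x\in U).$$ If $\theta'<1$ on $I$, then $D_-$ is weakly pseudoconvex along $\Sigma$; if $\theta'>1$ on $I$, then $D_+$ is weakly pseudoconvex along $\Sigma$.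
   Context: Coordinates on $\mathbb{C}^n$ are $z=x+iy$ with $x,y\in\mathbb{R}^n$; $|x|^2=x_1^2+\dots+x_n^2$, $|y|^2=y_1^2+\dots+y_n^2$. Primes on $\theta$ denote derivatives with respect to its single real variable (one-sided at $0$ if $0\in I$). For a real $C^2$ function $\rho$, the Levi form is $\mathcal{L}_\rho(z;v)=\sum_{j,k=1}^n\frac{\partial^2\rho}{\partial z_j\partial\bar z_k}(z)\,v_j\bar v_k$. If a domain $D$ is given near a real hypersurface $\Sigma$ as $\{\rho<0\}$, with $\rho$ of class $C^2$, $\Sigma=\{\rho=0\}$ and $d\rho\neq0$ on $\Sigma$, then $D$ is called strongly (resp. weakly) pseudoconvex along $\Sigma$ if $\mathcal{L}_\rho(p;v)>0$ (resp. $\geq0$) for every $p\in\Sigma$ and every nonzero $v$ in the complex tangent space $T_p^{\mathbb{C}}\Sigma=\{v\in\mathbb{C}^n:\sum_{k=1}^n\frac{\partial\rho}{\partial z_k}(p)v_k=0\}$. *)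

(* Defs.v *)
From HB Require Import structures.
From mathcomp Require Import all_boot all_order all_algebra.
From mathcomp Require Import all_classical all_reals all_analysis.
From mathcomp Require Import complex.
Set Implicit Arguments.
Unset Strict Implicit.
Unset Printing Implicit Defensive.
Import Order.TTheory GRing.Theory Num.Theory.
Import numFieldNormedType.Exports.
Local Open Scope classical_set_scope.
Local Open Scope ring_scope.
Local Open Scope complex_scope.

(* A point z = x + iy of C^n is encoded by the pair (x, y) of its real and
   imaginary parts, so that real differential calculus on C^n = R^2n is the
   library's calculus on a real normed module; vectors v of C^n at which the
   Levi form is evaluated are rows over R[i]. *)
Notation Cspace R n := ('rV[R]_n * 'rV[R]_n)%type.

Definition sqnorm (R : realType) (n : nat) (x : 'rV[R]_n) : R :=
  \sum_(i < n) x 0 i ^+ 2.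

(* O(n) acts transitively on each sphere centered at the origin. *)
Definition On_invariant (R : realType) (n : nat) (U : set 'rV[R]_n) : Prop :=
  forall x x' : 'rV[R]_n, U x -> sqnorm x' = sqnorm x -> U x'.

(* Derivative of f at t relative to I: the usual derivative at interior
   points of I, the one-sided derivative at an endpoint. *)
Definition diff_quot (R : realType) (f : R -> R) (t : R) : R -> R :=
  fun s => (f s - f t) / (s - t).

Definition derivable_within (R : realType) (I : set R) (f : R -> R) (t : R) :
  Prop := cvg (diff_quot f t @ within I t^').

Definition derive_within (R : realType) (I : set R) (f : R -> R) (t : R) : R :=
  lim (diff_quot f t @ within I t^').

Fixpoint Ck_within (R : realType) (k : nat) (I : set R) (f : R -> R) : Prop :=
  if k is k'.+1 then
    (forall t, I t -> derivable_within I f t) /\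
    Ck_within k' I (derive_within I f)
  else {within I, continuous f}.

(* Class C^k on an open subset W of a finite-dimensional real space, all
   directional derivatives being taken (not only those along a basis). *)
Fixpoint Ck_on (R : realType) (V : normedModType R) (k : nat) (W : set V)
    (f : V -> R) : Prop :=
  if k is k'.+1 then
    (forall p, W p -> differentiable f p) /\
    (forall u : V, Ck_on k' W ('D_u f))
  else forall p, W p -> {for p, continuous f}.

Section wirtinger.
Variables (R : realType) (n : nat).
Implicit Types (g : Cspace R n -> R[i]) (rho : Cspace R n -> R).
Implicit Types (p : Cspace R n) (j k : 'I_n).

Definition dir_x j : Cspace R n := (delta_mx 0 j, 0).
Definition dir_y j : Cspace R n := (0, delta_mx 0 j).

Definition cderive (u : Cspace R n) g p : R[i] :=
  ('D_u (fun q => complex.Re (g q)) p) +i* ('D_u (fun q => complex.Im (g q)) p).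

Definition dz j g p : R[i] :=
  (cderive (dir_x j) g p - 'i%C * cderive (dir_y j) g p) / 2.

Definition dzbar j g p : R[i] :=
  (cderive (dir_x j) g p + 'i%C * cderive (dir_y j) g p) / 2.

Definition levi_form rho p (v : 'rV[R[i]]_n) : R[i] :=
  \sum_(j < n) \sum_(k < n)
    dz j (dzbar k (fun q => (rho q)%:C)) p * v 0 j * (v 0 k)^*.

Definition complex_tangent rho p : set 'rV[R[i]]_n :=
  [set v | \sum_(k < n) dz k (fun q => (rho q)%:C) p * v 0 k = 0].

(* Near Sigma, i.e. on the open set W containing it, D is {rho < 0}. *)
Definition defining_function (D Sigma W : set (Cspace R n)) rho : Prop :=
  [/\ open W /\ Sigma `<=` W,
      Ck_on 2 W rho,
      D `&` W = [set p | W p /\ rho p < 0],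
      Sigma = [set p | W p /\ rho p = 0] &
      forall p, Sigma p -> exists u, 'd rho p u != 0].

(* In the order of R[i], 0 < c (resp. 0 <= c) means that c is real and
   positive (resp. nonnegative). *)
Definition strongly_pseudoconvex_along (D Sigma : set (Cspace R n)) : Prop :=
  exists W rho, defining_function D Sigma W rho /\
    forall p, Sigma p -> forall v, complex_tangent rho p v -> v != 0 ->
      0 < levi_form rho p v.

Definition weakly_pseudoconvex_along (D Sigma : set (Cspace R n)) : Prop :=
  exists W rho, defining_function D Sigma W rho /\
    forall p, Sigma p -> forall v, complex_tangent rho p v -> v != 0 ->
      0 <= levi_form rho p v.

End wirtinger.

Section domains.
Variables (R : realType) (n : nat) (U : set 'rV[R]_n) (theta : R -> R).

Definition hypersurface : set (Cspace R n) :=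
  [set p | U p.1 /\ sqnorm p.2 = theta (sqnorm p.1)].

Definition domain_minus : set (Cspace R n) :=
  [set p | U p.1 /\ sqnorm p.2 < theta (sqnorm p.1)].

Definition domain_plus : set (Cspace R n) :=
  [set p | U p.1 /\ sqnorm p.2 > theta (sqnorm p.1)].

End domains.

(* Main.v *)
Require Import Defs.
From HB Require Import structures.
From mathcomp Require Import all_boot all_order all_algebra.
From mathcomp Require Import all_classical all_reals all_analysis.
From mathcomp Require Import complex ring lra.
Import Order.TTheory GRing.Theory Num.Theory.
Import numFieldNormedType.Exports.
Local Open Scope classical_set_scope.
Local Open Scope ring_scope.

(** The function rho = |y|^2 - theta(|x|^2) defines the hypersurface, and its
Levi form can be computed.  Write v = a + ib for a tangent vector at x + iy,
r = |x|^2, and evaluate theta and its derivatives at r.  Then twice the Levi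
form of rho is

  q(v) = (1 - theta') |v|^2 - 2 theta'' ((x.a)^2 + (x.b)^2),

and v is in the complex tangent space iff y.b = theta' x.a and
y.a = - theta' x.b.  Under these two equations the Bessel inequality, applied
to the orthogonal vectors v and iv against (theta x, theta' r y), gives

  (r theta'^2 + theta) ((x.a)^2 + (x.b)^2) <= r theta |v|^2

([tangent_bessel]).  Hence the ratio of (x.a)^2 + (x.b)^2 to |v|^2 ranges
between 0 and r theta / (r theta'^2 + theta), and positivity of q at the two
ends of this range is exactly the pair of inequalities on theta
([levi_quad_bound]).  Both ends are attained because n > 1: the lower one at a
real vector orthogonal to x when y is parallel to x, the upper one at
(theta x, theta' r y) when y is orthogonal to x ([levi_condition_tests]).

Pseudoconvexity lets the defining function sigma be arbitrary, so the Levi form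
of sigma has to be compared with that of rho.  The real part of the Levi form
at v is a quarter of the sum of the second derivatives along v and iv
([levi_formE]), and the second derivative along a real tangent vector u can
be read off a curve that stays in the hypersurface: if the curve is
p + t v' + h(t) (0, y), with v' + h'(0) (0, y) = u, then differentiating
sigma = 0 twice along it gives
D_u D_u sigma = - h''(0) D_(0,y) sigma ([tangent_curve]).  As h does not depend
on sigma, the Levi forms of sigma and rho on the complex tangent space are in
the ratio of the derivatives of sigma and rho along (0, y), whose sign is
determined by the side on which the domain lies ([vertical_derive_sign]).

The two domains are treated together: they are the sets where
c (|y|^2 - theta(|x|^2)) is negative, for c = 1 and c = -1. *)

Set Implicit Arguments.
Unset Strict Implicit.
Unset Printing Implicit Defensive.

(** * Differentiability and derivatives relative to a subset of the line *)

Section Differentials.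
Context {R : realType} {V : normedModType R}.
Implicit Types (f g k s : V -> R) (x u : V).

Lemma is_diff_near f (df : {linear V -> R}) x : continuous df ->
  (forall e, 0 < e ->
     \forall z \near x, `|f z - f x - df (z - x)| <= e * `|z - x|) ->
  is_diff x f df.
Proof.
move=> dfc H.
have E : f \o shift x = cst (f x) + df +o_ 0 id.
  apply/eqaddoP => e e0; have := H _ e0; rewrite (near_shift 0).
  by apply: filterS => h /=; rewrite subr0 addrK opprD addrA.
have dE := diff_unique dfc E.
by apply: DiffDef => //; apply/diff_locallyP; rewrite dE; split.
Qed.

Lemma diff_nearP f x : differentiable f x -> forall e, 0 < e ->
  \forall z \near x, `|f z - f x - 'd f x (z - x)| <= e * `|z - x|.
Proof.
move=> /diff_locally/eqaddoP fx e e0; rewrite (near_shift 0).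
have := fx _ e0; apply: filterS => h /=.
by rewrite subr0 addrK opprD addrA.
Qed.

Lemma near_eq_differentiable f g x :
  (\near x, f x = g x) -> differentiable f x -> differentiable g x.
Proof.
move=> fg df; suff [] : is_diff x g ('d f x) by [].
apply: is_diff_near => [|e e0]; first exact: diff_continuous.
near=> z.
rewrite -(nbhs_singleton fg) -(near fg z) //.
by near: z; exact: diff_nearP.
Unshelve. all: by end_near. Qed.

(** At a zero of s the term with the derivative of k in the product rule
disappears, and continuity of k is enough. *)
Lemma is_diff_mul_vanish k s x : {for x, continuous k} ->
  differentiable s x -> s x = 0 -> is_diff x (k * s) (k x \*: 'd s x).
Proof.
move=> kc ds s0.
have [M [M0 HM]] : exists M, 0 < M /\ forall h, `|'d s x h| <= M * `|h|.
  have /linear_lipschitz [M M0 HM] := diff_continuous ds.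
  by exists M.
have Dc : continuous (k x \*: 'd s x).
  by move=> z; apply: continuousZl_tmp; exact: diff_continuous ds z.
apply: is_diff_near => // e e0.
have e1 : 0 < e / 2 / (M + 1) by rewrite !divr_gt0 ?addr_gt0.
have e2 : 0 < e / 2 / (`|k x| + 1) by rewrite !divr_gt0 ?ltr_wpDl.
near=> z.
have kz : `|k z - k x| <= e / 2 / (M + 1).
  by near: z; exact: (@cvgr_distC_le _ _ _ _ _ k (k x) kc _ e1).
have sz : `|s z - 'd s x (z - x)| <= 1 * `|z - x|.
  near: z; have := diff_nearP ds ltr01; rewrite s0.
  by apply: filterS => z; rewrite subr0.
have sz2 : `|s z - 'd s x (z - x)| <= e / 2 / (`|k x| + 1) * `|z - x|.
  near: z; have := diff_nearP ds e2; rewrite s0.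
  by apply: filterS => z; rewrite subr0.
rewrite /= !fctE s0 mulr0 subr0 /=.
have -> : k z * s z - k x * 'd s x (z - x) =
  (k z - k x) * s z + k x * (s z - 'd s x (z - x)) by ring.
rewrite (le_trans (ler_normD _ _)) // !normrM [e]splitr mulrDl lerD //.
  have szM : `|s z| <= (M + 1) * `|z - x|.
    rewrite -[s z](subrK ('d s x (z - x))) (le_trans (ler_normD _ _)) //.
    by rewrite mulrDl addrC lerD.
  rewrite (le_trans (ler_pM _ _ kz szM)) // mulrA divfK // gt_eqF //.
  by rewrite addr_gt0.
rewrite (le_trans (ler_wpM2l _ sz2)) // mulrA ler_wpM2r //.
rewrite mulrCA ler_piMr ?divr_ge0 ?(ltW e0) //.
by rewrite ler_pdivrMr ?mul1r ?ltr_wpDl // lerDl.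
Unshelve. all: by end_near. Qed.

(** Chain rule for an outer function that is only differentiable relative to I,
such as theta at an endpoint of its domain.  The difference quotient of f at
s x, completed by the value of the derivative at s x itself, is continuous
along s because s takes its values in I; so f o s is a constant plus the
product of a continuous function and of s - s x, which vanishes at x. *)
Lemma is_diff_within_comp (I : set R) (f : R -> R) s x :
  (\near x, I (s x)) -> differentiable s x -> derivable_within I f (s x) ->
  is_diff x (f \o s) (derive_within I f (s x) \*: 'd s x).
Proof.
move=> Is ds df; set t0 := s x; set l := derive_within I f t0.
pose m t := if t == t0 then l else diff_quot f t0 t.
have mt0 : m t0 = l by rewrite /m eqxx.
have fE : f \o s = cst (f t0) + (m \o s) * (s - cst t0).
  apply/funext => z; rewrite !fctE /= /m; case: eqVneq => [->|st0].
    by rewrite subrr mulr0 addr0.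
  by rewrite /diff_quot divfK ?subr_eq0 // addrC subrK.
have mc : {for x, continuous (m \o s)}.
  apply/(@cvgrPdist_lt _ _ _ (nbhs x)) => e e0 /=.
  have /(@cvgrPdist_lt _ _ _ (within I t0^')) /(_ _ e0) := df.
  move=> /(differentiable_continuous ds) H.
  near=> z.
  rewrite /= mt0 /m; case: eqVneq => [_|st0]; first by rewrite subrr normr0.
  have : [set z | s z != t0 -> I (s z) -> `|l - diff_quot f t0 (s z)| < e] z.
    by near: z; exact: H.
  by apply => //; near: z.
have [dsx dsE] : is_diff x (s - cst t0) ('d s x).
  have := differentiableP ds => dsP.
  by apply: (is_diff_eq (is_diffB dsP (is_diff_cst _ _))); rewrite subr0.
have s0 : (s - cst t0) x = 0 by rewrite !fctE subrr.
have dmsP := is_diff_mul_vanish mc dsx s0.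
rewrite fE; apply: (is_diff_eq (is_diffD (is_diff_cst _ _) dmsP)).
by rewrite add0r dsE /= mt0.
Unshelve. all: by end_near. Qed.
End Differentials.

(** * The Levi form and the complex tangent space in real terms *)

Section LeviForm.
Context {R : realType} {n : nat}.
Implicit Types (rho f : Cspace R n -> R) (p u w : Cspace R n).
Implicit Types (W : set (Cspace R n)) (v : 'rV[R[i]]_n).

Definition real_vec v : Cspace R n :=
  (map_mx (@complex.Re R) v, map_mx (@complex.Im R) v).

Lemma invC2E : (2^-1 : R[i]) = ((2^-1 : R)%:C)%C.
Proof. by rewrite fmorphV rmorph_nat. Qed.

Definition mul_i u : Cspace R n := (- u.2, u.1).

Definition hess rho p u w : R := 'D_u ('D_w rho) p.

Lemma derive_coord f p u : differentiable f p ->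
  'D_u f p = \sum_(j < n) (u.1 0 j * 'D_(dir_x R j) f p +
                           u.2 0 j * 'D_(dir_y R j) f p).
Proof.
move=> df.
have uE : u = \sum_(j < n) (u.1 0 j *: dir_x R j + u.2 0 j *: dir_y R j).
  case: u => a b /=; rewrite big_split /=.
  have -> : \sum_(j < n) a 0 j *: dir_x R j = (a, 0).
    rewrite [X in _ = (X, _)]row_sum_delta.
    elim/big_rec2 : _ => // j x1 _ _ ->.
    by congr pair; rewrite /= scaler0 add0r.
  have -> : \sum_(j < n) b 0 j *: dir_y R j = (0, b).
    rewrite [X in _ = (_, X)]row_sum_delta.
    elim/big_rec2 : _ => // j x1 _ _ ->.
    by congr pair; rewrite /= scaler0 add0r.
  by congr pair; rewrite /= ?addr0 ?add0r.
rewrite deriveE // {1}uE linear_sum; apply: eq_bigr => j _.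
by rewrite linearD !linearZ /= !deriveE.
Qed.

Section RegularFunction.
Variables (W : set (Cspace R n)) (rho : Cspace R n -> R).
Hypotheses (Wo : open W) (rhoC : Ck_on 2 W rho).

Lemma Ck2_diff p : W p -> differentiable rho p.
Proof. by move=> Wp; case: rhoC => H _; apply: H. Qed.

Lemma Ck2_diff2 p u : W p -> differentiable ('D_u rho) p.
Proof. by move=> Wp; case: rhoC => _ /(_ u) [H _]; apply: H. Qed.

(** Bilinearity of iterated directional derivatives: on the open set W the first
derivative is linear in its direction at every point, which gives linearity in
w, and linearity in u is that of the differential of D_w rho. *)
Lemma hess_coord p u w : W p -> hess rho p u w =
  \sum_(j < n) \sum_(k < n)
   (u.1 0 j * w.1 0 k * hess rho p (dir_x R j) (dir_x R k) +
    u.1 0 j * w.2 0 k * hess rho p (dir_x R j) (dir_y R k) +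
    u.2 0 j * w.1 0 k * hess rho p (dir_y R j) (dir_x R k) +
    u.2 0 j * w.2 0 k * hess rho p (dir_y R j) (dir_y R k)).
Proof.
move=> Wp; have dk z u' : derivable ('D_z rho) p u'.
  by apply/diff_derivable/Ck2_diff2.
have E u' : hess rho p u' w = \sum_(k < n)
    (w.1 0 k * hess rho p u' (dir_x R k) + w.2 0 k * hess rho p u' (dir_y R k)).
  transitivity ('D_u' (\sum_(k < n)
      (w.1 0 k *: 'D_(dir_x R k) rho + w.2 0 k *: 'D_(dir_y R k) rho)) p).
    apply: near_eq_derive; near=> q.
    rewrite fct_sumE; apply/derive_coord/Ck2_diff.
    by near: q; exact: open_nbhs_nbhs.
  rewrite derive_sum => [|k]; last by apply: derivableD; exact: derivableZ.
  apply: eq_bigr => k _.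
  transitivity ('D_u' (w.1 0 k *: 'D_(dir_x R k) rho) p +
                'D_u' (w.2 0 k *: 'D_(dir_y R k) rho) p).
    by apply: deriveD; exact: derivableZ.
  by congr (_ + _); exact: deriveZ.
transitivity (\sum_(j < n) (u.1 0 j * hess rho p (dir_x R j) w +
                             u.2 0 j * hess rho p (dir_y R j) w)).
  exact: derive_coord (Ck2_diff2 _ Wp).
apply: eq_bigr => j _; rewrite (E (dir_x R j)) (E (dir_y R j)).
move: (hess rho p) => h; rewrite !mulr_sumr -big_split /=.
by apply: eq_bigr => k _; ring.
Unshelve. all: by end_near. Qed.

Lemma dzbarE k q : dzbar k (fun q => (rho q)%:C%C) q =
  ('D_(dir_x R k) rho q / 2 +i* ('D_(dir_y R k) rho q / 2))%C.
Proof.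
rewrite /dzbar /cderive /= (_ : (fun q : Cspace R n => 0) = cst 0) //.
rewrite !derive_cst invC2E.
move: ('D_(dir_x R k) rho q) ('D_(dir_y R k) rho q) => a b.
by apply/eqP; rewrite eq_complex /=; apply/andP; split; apply/eqP; ring.
Qed.

Lemma dzE k q : dz k (fun q => (rho q)%:C%C) q =
  ('D_(dir_x R k) rho q / 2 +i* - ('D_(dir_y R k) rho q / 2))%C.
Proof.
rewrite /dz /cderive /= (_ : (fun q : Cspace R n => 0) = cst 0) //.
rewrite !derive_cst invC2E.
move: ('D_(dir_x R k) rho q) ('D_(dir_y R k) rho q) => a b.
by apply/eqP; rewrite eq_complex /=; apply/andP; split; apply/eqP; ring.
Qed.

Lemma dz_dzbarE j k p : W p ->
  dz j (dzbar k (fun q => (rho q)%:C%C)) p =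
  ((hess rho p (dir_x R j) (dir_x R k) + hess rho p (dir_y R j) (dir_y R k)) / 4
   +i* ((hess rho p (dir_x R j) (dir_y R k)
         - hess rho p (dir_y R j) (dir_x R k)) / 4))%C.
Proof.
move=> Wp.
have dk u z : 'D_u (2^-1 *: 'D_z rho) p = 2^-1 * hess rho p u z.
  by apply: deriveZ; exact/diff_derivable/Ck2_diff2.
have cE u : cderive u (dzbar k (fun q => (rho q)%:C%C)) p =
    ((2^-1 * hess rho p u (dir_x R k)) +i* (2^-1 * hess rho p u (dir_y R k)))%C.
  congr (_ +i* _)%C; (apply: etrans; last exact: dk); congr ('D_u _ p).
    by apply/funext => q; rewrite dzbarE /= mulrC.
  by apply/funext => q; rewrite dzbarE /= mulrC.
rewrite /dz !cE invC2E; move: (hess rho p) => h.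
by apply/eqP; rewrite eq_complex /=; apply/andP; split; apply/eqP; field.
Qed.

(** Bilinearity of [hess] turns the double sum over coordinates into its values
at v and iv.  The imaginary part is the defect of symmetry of the second
derivative. *)
Lemma levi_formE p v : W p -> let V := real_vec v in let JV := mul_i V in
  levi_form rho p v =
  ((hess rho p V V + hess rho p JV JV) / 4
   +i* ((hess rho p V JV - hess rho p JV V) / 4))%C.
Proof.
move=> Wp V JV; apply/eqP; rewrite eq_complex /levi_form /=.
rewrite !(hess_coord _ _ Wp) -!sumrN -!big_split /= !mulr_suml.
rewrite !raddf_sum.
apply/andP; split; apply/eqP; apply: eq_bigr => j _.
  rewrite -big_split /= mulr_suml raddf_sum; apply: eq_bigr => k _.
  rewrite dz_dzbarE // !mxE; move: (hess rho p) => h.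
  by case: (v 0 j) (v 0 k) => [a b] [c d] /=; field.
rewrite -sumrN -big_split /= mulr_suml raddf_sum; apply: eq_bigr => k _.
rewrite dz_dzbarE // !mxE; move: (hess rho p) => h.
by case: (v 0 j) (v 0 k) => [a b] [c d] /=; field.
Qed.

Lemma complex_tangentE p v : W p -> complex_tangent rho p v <->
  'D_(real_vec v) rho p = 0 /\ 'D_(mul_i (real_vec v)) rho p = 0.
Proof.
move=> Wp; rewrite /complex_tangent /=.
have -> : \sum_(k < n) dz k (fun q => (rho q)%:C%C) p * v 0 k =
    ('D_(real_vec v) rho p / 2 +i* - ('D_(mul_i (real_vec v)) rho p / 2))%C.
  rewrite !(derive_coord _ (Ck2_diff Wp)) !mulr_suml -sumrN.
  apply/eqP; rewrite eq_complex !raddf_sum /=.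
  apply/andP; split; apply/eqP; apply: eq_bigr => k _.
    rewrite dzE !mxE; move: ('D_(dir_x R k) rho p) ('D_(dir_y R k) rho p).
    by case: (v 0 k) => c d e f /=; field.
  rewrite dzE !mxE; move: ('D_(dir_x R k) rho p) ('D_(dir_y R k) rho p).
  by case: (v 0 k) => c d e f /=; field.
move: ('D_(real_vec v) rho p) ('D_(mul_i (real_vec v)) rho p) => a b.
split=> [[] /eqP h1 /eqP h2|[-> ->]]; last first.
  by rewrite !mul0r oppr0.
move: h1 h2; rewrite oppr_eq0 !mulf_eq0 !invr_eq0 !pnatr_eq0 /= !orbF.
by move=> /eqP -> /eqP ->.
Qed.
End RegularFunction.
End LeviForm.

(** * The Euclidean inner product and its derivatives *)

Section DotProduct.
Context {R : realType} {n : nat}.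
Implicit Types x y z : 'rV[R]_n.

Definition dot x y : R := \sum_(i < n) x 0 i * y 0 i.

Lemma dotC x y : dot x y = dot y x.
Proof. by apply: eq_bigr => i _; rewrite mulrC. Qed.

Lemma dotDl x y z : dot (x + y) z = dot x z + dot y z.
Proof. by rewrite -big_split; apply: eq_bigr => i _; rewrite mxE mulrDl. Qed.

Lemma dotZl (k : R) x z : dot (k *: x) z = k * dot x z.
Proof. by rewrite mulr_sumr; apply: eq_bigr => i _; rewrite mxE mulrA. Qed.

Lemma dotNl x z : dot (- x) z = - dot x z.
Proof. by rewrite -scaleN1r dotZl mulN1r. Qed.

Lemma dot0l z : dot 0 z = 0.
Proof. by rewrite -(scale0r (0 : 'rV[R]_n)) dotZl mul0r. Qed.

Lemma dotDr x y z : dot z (x + y) = dot z x + dot z y.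
Proof. by rewrite !(dotC z) dotDl. Qed.

Lemma dotZr (k : R) x z : dot z (k *: x) = k * dot z x.
Proof. by rewrite !(dotC z) dotZl. Qed.

Lemma dotNr x z : dot z (- x) = - dot z x.
Proof. by rewrite !(dotC z) dotNl. Qed.

Lemma dot0r z : dot z 0 = 0.
Proof. by rewrite dotC dot0l. Qed.

Lemma sqnormE x : sqnorm x = dot x x.
Proof. by apply: eq_bigr => i _; rewrite expr2. Qed.

Lemma dot_ge0 x : 0 <= dot x x.
Proof. by rewrite -sqnormE sumr_ge0 // => i _; rewrite sqr_ge0. Qed.

Lemma dot_gt0 x : x != 0 -> 0 < dot x x.
Proof.
move=> x0; rewrite lt0r dot_ge0 andbT; apply: contra x0.
rewrite -sqnormE psumr_eq0 => [/allP H|i _]; last exact: sqr_ge0.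
apply/eqP/rowP => i; rewrite mxE; apply/eqP; rewrite -sqrf_eq0.
by apply: H; rewrite mem_index_enum.
Qed.
End DotProduct.

Section DirectionalDerivatives.
Context {R : realType} {V : normedModType R}.
Implicit Types (f g s : V -> R) (p u : V) (D : V -> R).

(** Differentiability together with all directional derivatives, so that a
single rule per operation produces both. *)
Definition has_derive f p D :=
  differentiable f p /\ forall u, 'D_u f p = D u.

Lemma has_derive_eq f p D D' :
  has_derive f p D -> (forall u, D u = D' u) -> has_derive f p D'.
Proof. by move=> [df E] DD; split=> // u; rewrite E DD. Qed.

Lemma has_derive_near f g p D :
  (\near p, f p = g p) -> has_derive f p D -> has_derive g p D.
Proof.
move=> fg [df E]; split; first exact: near_eq_differentiable df.
by move=> u; rewrite -E; apply/esym/near_eq_derive.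
Qed.

Lemma has_deriveD f g p D D' : has_derive f p D -> has_derive g p D' ->
  has_derive (f + g) p (fun u => D u + D' u).
Proof.
move=> [df E] [dg E']; split; first exact: differentiableD.
move=> u; transitivity ('D_u f p + 'D_u g p); last by rewrite E E'.
by apply: deriveD; exact: diff_derivable.
Qed.

Lemma has_deriveZ k f p D : has_derive f p D ->
  has_derive (k *: f) p (fun u => k * D u).
Proof.
move=> [df E]; split; first exact: differentiableZ.
move=> u; transitivity (k * 'D_u f p); last by rewrite E.
by apply: deriveZ; exact: diff_derivable.
Qed.

Lemma has_deriveM f g p D D' : has_derive f p D -> has_derive g p D' ->
  has_derive (f * g) p (fun u => f p * D' u + g p * D u).
Proof.
move=> [df E] [dg E']; split; first exact: differentiableM.
move=> u; transitivity (f p * 'D_u g p + g p * 'D_u f p); last by rewrite E E'.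
by apply: deriveM; exact: diff_derivable.
Qed.

Lemma has_derive_linear f p : linear f -> continuous f -> has_derive f p f.
Proof.
move=> fl fc.
pose F : {linear V -> R} :=
  HB.pack f (GRing.isLinear.Build R V R *:%R f fl).
have df : differentiable F p by exact: linear_differentiable.
by split=> // u; rewrite (deriveE _ df) (@diff_lin _ _ _ F).
Qed.

Lemma has_derive_within_comp (I : set R) (h : R -> R) s p D :
  (\near p, I (s p)) -> has_derive s p D -> derivable_within I h (s p) ->
  has_derive (h \o s) p (fun u => derive_within I h (s p) * D u).
Proof.
move=> Is [ds E] dh; have [df dfE] := is_diff_within_comp Is ds dh.
by split=> // u; rewrite deriveE // dfE -E deriveE.
Qed.

Lemma has_derive_sum n (f : 'I_n -> V -> R) p (D : 'I_n -> V -> R) :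
  (forall i, has_derive (f i) p (D i)) ->
  has_derive (fun q => \sum_(i < n) f i q) p (fun u => \sum_(i < n) D i u).
Proof.
move=> H; rewrite -fct_sumE; split.
  by apply: differentiable_sum => i; have [] := H i.
move=> u; transitivity (\sum_(i < n) 'D_u (f i) p).
  by apply: derive_sum => i; apply: diff_derivable; have [] := H i.
by apply: eq_bigr => i _; have [_ ->] := H i.
Qed.
End DirectionalDerivatives.

Section DotCalculus.
Context {R : realType} {n : nat} {V : normedModType R}.
Variable pi : {linear V -> 'rV[R]_n}.
Hypothesis pi_cont : continuous pi.

Let has_derive_coord i p : has_derive (fun q => pi q 0 i) p (fun u => pi u 0 i).
Proof.
apply: has_derive_linear => [k u v|q]; first by rewrite linearP !mxE.
apply: (@continuous_comp V 'rV[R]_n R pi (fun M => M 0 i)).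
  exact: pi_cont.
exact: coord_continuous.
Qed.

Lemma has_derive_dot a p :
  has_derive (fun q => dot (pi q) a) p (fun u => dot (pi u) a).
Proof.
have H := has_derive_sum (fun i => has_deriveZ (a 0 i) (has_derive_coord i p)).
rewrite [X in has_derive X](_ : _ =
    (fun q => \sum_(i < n) (a 0 i *: (fun q => pi q 0 i)) q)); last first.
  by apply/funext => q; apply: eq_bigr => i _; rewrite mulrC.
by apply: (has_derive_eq H) => u; apply: eq_bigr => i _; rewrite mulrC.
Qed.

Lemma has_derive_sqnorm p :
  has_derive (fun q => sqnorm (pi q)) p (fun u => 2 * dot (pi p) (pi u)).
Proof.
have H := has_derive_sum
  (fun i => has_deriveM (has_derive_coord i p) (has_derive_coord i p)).
have -> : (fun q => sqnorm (pi q)) =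
    (fun q => \sum_(i < n) ((fun q => pi q 0 i) * (fun q => pi q 0 i)) q).
  by apply/funext => q; apply: eq_bigr => i _; rewrite expr2.
apply: (has_derive_eq H) => u; rewrite /dot mulr_sumr.
by apply: eq_bigr => i _ /=; ring.
Qed.
End DotCalculus.

(** * The standard defining function is of class C^2 *)

Section StandardDefiningFunction.
Context {R : realType} {n : nat} (U : set 'rV[R]_n) (theta : R -> R).
Local Notation I := [set sqnorm x | x in U].
Local Notation theta' := (derive_within I theta).
Local Notation theta'' := (derive_within I theta').
Hypotheses (Uo : open U) (thetaC : Ck_within 2 I theta).
Variable c : R.

Definition tube : set (Cspace R n) := [set p | U p.1].

Definition std_fun (p : Cspace R n) : R :=
  c * (sqnorm p.2 - theta (sqnorm p.1)).

Definition std_grad (p u : Cspace R n) : R :=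
  c * (2 * dot p.2 u.2 - theta' (sqnorm p.1) * (2 * dot p.1 u.1)).

Definition std_hess (p w u : Cspace R n) : R :=
  c * (2 * dot w.2 u.2 - (theta' (sqnorm p.1) * (2 * dot w.1 u.1) +
       2 * dot p.1 u.1 * (theta'' (sqnorm p.1) * (2 * dot p.1 w.1)))).

Lemma tube_open : open tube.
Proof. by apply: open_comp => // p _; exact: cvg_fst. Qed.

Lemma tube_near p : tube p -> \near p, I (sqnorm p.1).
Proof.
move=> Up; have := open_nbhs_nbhs (conj tube_open Up).
by apply: filterS => q Uq; exists q.1.
Qed.

Let derive_sq1 p := has_derive_sqnorm
  (pi := fst : {linear Cspace R n -> 'rV[R]_n}) (fun q => cvg_fst) p.
Let derive_sq2 p := has_derive_sqnorm
  (pi := snd : {linear Cspace R n -> 'rV[R]_n}) (fun q => cvg_snd) p.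
Let derive_dot1 a p := has_derive_dot
  (pi := fst : {linear Cspace R n -> 'rV[R]_n}) (fun q => cvg_fst) a p.
Let derive_dot2 a p := has_derive_dot
  (pi := snd : {linear Cspace R n -> 'rV[R]_n}) (fun q => cvg_snd) a p.

Lemma std_fun_derive p : tube p -> has_derive std_fun p (std_grad p).
Proof.
move=> Up.
have dth : derivable_within I theta (sqnorm p.1).
  by case: thetaC => H _; apply: H; exists p.1.
have H1 := has_derive_within_comp (tube_near Up) (derive_sq1 p) dth.
have H := has_deriveZ c (has_deriveD (derive_sq2 p) (has_deriveZ (-1) H1)).
rewrite [X in has_derive X](_ : _ = c *: ((fun q => sqnorm q.2) +
   -1 *: (theta \o (fun q => sqnorm q.1)))).
  by apply: (has_derive_eq H) => u; rewrite mulN1r.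
by apply/funext => q; rewrite /std_fun -[- theta _]mulN1r.
Qed.

Lemma std_fun_derive2 u p : tube p ->
  has_derive ('D_u std_fun) p (fun w => std_hess p w u).
Proof.
move=> Up.
have dth : derivable_within I theta' (sqnorm p.1).
  by case: thetaC => _ [H _]; apply: H; exists p.1.
have H1 := has_derive_within_comp (tube_near Up) (derive_sq1 p) dth.
have H2 := has_deriveM H1 (has_deriveZ 2 (derive_dot1 u.1 p)).
have H := has_deriveZ c (has_deriveD (has_deriveZ 2 (derive_dot2 u.2 p))
                                     (has_deriveZ (-1) H2)).
apply: (has_derive_near _ (has_derive_eq H _)) => [|w]; last first.
  by rewrite mulN1r.
near=> q; rewrite (std_fun_derive _).2.
  by rewrite /std_grad -[- (_ * _)]mulN1r.
by near: q; exact: open_nbhs_nbhs (conj tube_open Up).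
Unshelve. all: by end_near. Qed.

(** Only the composite with |x|^2 matters: over the origin it is of class C^2 in
spite of the one-sided derivatives of theta, since |x|^2 maps a neighbourhood
of every point of U into the domain of theta. *)
Lemma std_fun_Ck2 : Ck_on 2 tube std_fun.
Proof.
split=> [p Up|u]; first by have [] := std_fun_derive Up.
split=> [p Up|w p Up]; first by have [] := std_fun_derive2 u Up.
have cd f D : has_derive f p D -> {for p, continuous f}.
  by move=> [/differentiable_continuous].
have dth : derivable_within I theta' (sqnorm p.1).
  by case: thetaC => _ [H _]; apply: H; exists p.1.
have c1 := cd _ _ (has_derive_within_comp (tube_near Up) (derive_sq1 p) dth).
have c2 : {for p, continuous (theta'' \o (fun q : Cspace R n => sqnorm q.1))}.
  have th2 : {within I, continuous theta''} by case: thetaC => _ [].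
  have Ip : I (sqnorm p.1) by exists p.1.
  have sc : {for p, continuous (fun q : Cspace R n => sqnorm q.1)}.
    exact: cd (derive_sq1 p).
  move/subspace_continuousP: th2 => /(_ _ Ip) th2 A /th2 /sc.
  rewrite /= => HA.
  change (\forall q \near p, A (theta'' (sqnorm q.1))); near=> q.
  have : [set q | I (sqnorm q.1) -> A (theta'' (sqnorm q.1))] q.
    by near: q; exact: HA.
  by apply; near: q; exact: tube_near.
have c3 a : {for p, continuous (fun q : Cspace R n => dot q.1 a)}.
  exact: cd (derive_dot1 a p).
have cc : {for p, continuous (fun q => std_hess q w u)}.
  apply: continuousM; first exact: cvg_cst.
  apply: continuousB; first exact: cvg_cst.
  apply: continuousD; first by apply: continuousM => //; exact: cvg_cst.
  apply: continuousM; first by apply: continuousM => //; exact: cvg_cst.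
  apply: continuousM => //; apply: continuousM => //; exact: cvg_cst.
rewrite /prop_for/continuous_at (std_fun_derive2 u Up).2.
apply: cvg_trans cc; apply: near_eq_cvg.
near=> q; rewrite (std_fun_derive2 u _).2 //.
by near: q; exact: open_nbhs_nbhs (conj tube_open Up).
Unshelve. all: by end_near. Qed.
End StandardDefiningFunction.

(** * Derivatives along a curve in a zero set *)

Section Curves.
Context {R : realType} {V : normedModType R}.
Implicit Types (f : V -> R) (W : set V).

Lemma derive_lin f p u w (k : R) : differentiable f p ->
  'D_(u + k *: w) f p = 'D_u f p + k * 'D_w f p.
Proof.
move=> df; transitivity ('d f p u + k *: 'd f p w).
  by rewrite deriveE // linearD linearZ.
by congr (_ + _ * _); rewrite deriveE.
Qed.

Lemma is_derive_comp_curve f (g : R -> V) t v :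
  is_derive t (1 : R) g v -> differentiable f (g t) ->
  is_derive t (1 : R) (f \o g) ('D_v f (g t)).
Proof.
move=> [dg gv] df.
have dg' : differentiable g t by apply/derivable1_diffP.
apply: DeriveDef.
  by apply/derivable1_diffP/differentiable_comp.
transitivity ('d f (g t) v); last by rewrite deriveE.
rewrite deriveE; last exact: differentiable_comp.
transitivity (('d f (g t) \o 'd g t) 1); first by rewrite diff_comp.
by rewrite /= -gv; congr ('d f (g t) _); rewrite deriveE.
Qed.

Lemma is_derive_scalel (k : R -> R) t d (w : V) :
  is_derive t (1 : R) k d -> is_derive t (1 : R) (fun t => k t *: w) (d *: w).
Proof.
move=> [dk <-].
have dk' : differentiable k t by apply/derivable1_diffP.
have dkw := differentiableZl w dk'.
apply: DeriveDef; first exact/derivable1_diffP.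
transitivity ('d k t 1 *: w); last by rewrite deriveE.
by rewrite deriveE // diffZl.
Qed.

Lemma derive_le0 f p w : derivable f p w -> f p = 0 ->
  (\forall t \near (0 : R)^'+, f (t *: w + p) <= 0) -> 'D_w f p <= 0.
Proof.
move=> df fp0 H; rewrite /derive cvg_at_rightE //; apply: limr_le.
  by apply: cvgP; exact: cvg_dnbhs_at_right df.
near=> t; rewrite fp0 subr0 /= /GRing.scale /=.
have t0 : 0 < t by [].
by rewrite pmulr_rle0 ?invr_gt0 //; near: t.
Unshelve. all: by end_near. Qed.

Section SecondOrder.
Variables (W : set V) (f : V -> R) (p v y : V) (h h1 : R -> R) (h2 : R).
Hypotheses (Wo : open W) (fC : Ck_on 2 W f) (Wp : W p).
Hypotheses (h0 : h 0 = 0).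
Hypothesis (dh : \forall t \near (0 : R), is_derive t (1 : R) h (h1 t)).
Hypothesis (dh1 : is_derive (0 : R) (1 : R) h1 h2).

Let curve (t : R) : V := p + (t *: v + h t *: y).

Hypothesis (f0 : \forall t \near (0 : R), W (curve t) -> f (curve t) = 0).

Let curve_derive t d : is_derive t (1 : R) h d ->
  is_derive t (1 : R) curve (v + d *: y).
Proof.
move=> hd; have Dv := is_derive_scalel v (is_derive_id t (1 : R)).
apply: (is_derive_eq (is_deriveD (is_derive_cst p t (1 : R))
  (is_deriveD Dv (is_derive_scalel y hd)))).
by rewrite add0r scale1r.
Qed.

Let curve0 : curve 0 = p.
Proof. by rewrite /curve h0 !scale0r !addr0. Qed.

Lemma curve_near : \forall t \near (0 : R), W (curve t).
Proof.
have [dc _] := curve_derive (nbhs_singleton dh).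
have cc : {for 0, continuous curve}.
  by apply: differentiable_continuous; apply/derivable1_diffP.
by apply: cc; rewrite curve0; exact: open_nbhs_nbhs.
Qed.

(* The derivative of f along the curve, expanded by linearity in the velocity
   v + h1 t *: y, so that only the scalar h1 has to be derived again. *)
Let phi (t : R) := 'D_v f (curve t) + h1 t * 'D_y f (curve t).

Let phi0 : \forall t \near (0 : R), phi t = 0.
Proof.
have F0 : \forall t \near (0 : R), (f \o curve) t = cst 0 t.
  by near=> t; rewrite /=; apply: (near f0 t) => //; near: t; exact: curve_near.
have := near_join F0; apply: filter_app.
near=> t => F0t.
have dht : is_derive t (1 : R) h (h1 t) by near: t.
have dft : differentiable f (curve t).
  by case: fC => H _; apply: H; near: t; exact: curve_near.
have [_ E] := is_derive_comp_curve (curve_derive dht) dft.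
rewrite /phi -derive_lin // -E (near_eq_derive _ F0t).
exact: derive_cst.
Unshelve. all: by end_near. Qed.

Lemma curve_derive1 : 'D_(v + h1 0 *: y) f p = 0.
Proof.
have := nbhs_singleton phi0; rewrite /phi curve0; apply: etrans.
by apply: derive_lin; case: fC => H _; exact: H.
Qed.

(** A function that vanishes along the curve has second derivative zero there;
the chain rule splits it into the second derivative along the velocity and the
first derivative along the acceleration h2 *: y. *)
Lemma curve_derive2 : let u := v + h1 0 *: y in
  'D_u ('D_u f) p = - (h2 * 'D_y f p).
Proof.
move=> u; have [C1 C2] := fC.
have C3 w : differentiable ('D_w f) p by case: (C2 w) => H _; exact: H.
have cu : is_derive (0 : R) (1 : R) curve u := curve_derive (nbhs_singleton dh).
have Dw w : is_derive (0 : R) (1 : R) ('D_w f \o curve) ('D_u ('D_w f) p).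
  by have := C3 w; rewrite -curve0; exact: is_derive_comp_curve.
have E : 'D_u ('D_u f) p = 'D_u ('D_v f) p + h1 0 * 'D_u ('D_y f) p.
  transitivity ('D_u ('D_v f + h1 0 *: 'D_y f) p).
    apply: near_eq_derive; near=> q; rewrite derive_lin //.
    by apply: C1; near: q; exact: open_nbhs_nbhs.
  have dw w : derivable ('D_w f) p u by exact: diff_derivable.
  transitivity ('D_u ('D_v f) p + 'D_u (h1 0 *: 'D_y f) p).
    by apply: deriveD => //; exact: derivableZ.
  by congr (_ + _); exact: deriveZ.
have [_ P] := is_deriveD (Dw v) (is_deriveM dh1 (Dw y)).
have : 'D_(1 : R) phi 0 = 0.
  by rewrite (near_eq_derive _ phi0) derive_cst.
rewrite [LHS]P /= curve0 => /eqP.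
rewrite addrA -E addr_eq0 => /eqP ->; congr (- _); exact: mulrC.
Unshelve. all: by end_near. Qed.
End SecondOrder.
End Curves.

(** * Extremal vectors for the Levi form *)

Section TestVectors.
Context {R : realType} {n : nat}.
Implicit Types x y a b : 'rV[R]_n.

Lemma exists_orthogonal x : (1 < n)%N -> exists2 v, v != 0 & dot x v = 0.
Proof.
move=> n1; pose i := Ordinal (ltnW n1); pose j := Ordinal n1.
have ij : (i == j) = false by [].
have dd k : dot x (delta_mx 0 k) = x 0 k.
  rewrite /dot (bigD1 k) //= big1 ?addr0 => [|l lk].
    by rewrite mxE !eqxx mulr1.
  by rewrite mxE (negPf lk) andbF mulr0.
have neq0 (v : 'rV[R]_n) k : v 0 k != 0 -> v != 0.
  by apply: contraNneq => ->; rewrite mxE.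
have [xj0|xj0] := eqVneq (x 0 j) 0.
  exists (delta_mx 0 j); last by rewrite dd.
  by apply: (neq0 _ j); rewrite mxE !eqxx oner_neq0.
exists (x 0 j *: delta_mx 0 i - x 0 i *: delta_mx 0 j).
  by apply: (neq0 _ i); rewrite !mxE !eqxx ij andbF mulr0 subr0 mulr1.
by rewrite dotDr dotNr !dotZr !dd; ring.
Qed.

Lemma exists_scaled (v : 'rV[R]_n) (t : R) : v != 0 -> 0 <= t ->
  exists k : R, sqnorm (k *: v) = t.
Proof.
move=> v0 t0; have d0 := dot_gt0 v0.
exists (Num.sqrt (t / dot v v)).
rewrite sqnormE dotZl dotZr mulrA -expr2 sqr_sqrtr ?divfK ?gt_eqF //.
by rewrite divr_ge0 // ltW.
Qed.

(** With e = (a, b) and Je = (b, -a), orthogonal and of equal norm, and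
P = (th x, m r y), the hypotheses say that P.e = N x.a and P.Je = N x.b, where
N = r m^2 + th, while |P|^2 = r th N.  The inequality is the Bessel inequality
for P. *)
Lemma tangent_bessel x y a b (m : R) :
  dot y b = m * dot x a -> dot y a = - (m * dot x b) ->
  let r := dot x x in let th := dot y y in
  0 < th -> 0 < dot a a + dot b b ->
  (r * m ^+ 2 + th) * (dot x a ^+ 2 + dot x b ^+ 2) <=
  r * th * (dot a a + dot b b).
Proof.
move=> yb ya r th th0; set S := (_ + _) => S0.
set N := r * m ^+ 2 + th.
have N0 : 0 < N by rewrite ltr_wpDl // mulr_ge0 ?dot_ge0 ?sqr_ge0.
(* (z1, z2) is |e|^2 times the component of P orthogonal to e and Je. *)
pose z1 := (S * th) *: x - (N * dot x a) *: a - (N * dot x b) *: b.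
pose z2 := (S * (m * r)) *: y - (N * dot x a) *: b + (N * dot x b) *: a.
have : 0 <= dot z1 z1 + dot z2 z2 by rewrite addr_ge0 ?dot_ge0.
have -> : dot z1 z1 + dot z2 z2 =
    S * N * (r * th * S - N * (dot x a ^+ 2 + dot x b ^+ 2)).
  rewrite /z1 /z2 !(dotDl, dotDr, dotNl, dotNr, dotZl, dotZr).
  rewrite (dotC a x) (dotC b x) (dotC b a) (dotC a y) (dotC b y) yb ya.
  by rewrite -/r -/th /S /N; ring.
by rewrite pmulr_rge0 ?mulr_gt0 // subr_ge0.
Qed.
End TestVectors.

(** * The Levi condition on the hypersurface *)

Section Hypersurface.
Context {R : realType} {n : nat} (U : set 'rV[R]_n) (theta : R -> R).
Local Notation I := [set sqnorm x | x in U].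
Local Notation theta' := (derive_within I theta).
Local Notation theta'' := (derive_within I theta').
Local Notation Sigma := (hypersurface U theta).
Hypotheses (Uo : open U) (thetaC : Ck_within 2 I theta).
Hypothesis theta_gt0 : forall t, I t -> 0 < theta t.

(** While x moves along a line and a component of y orthogonal to y grows
linearly, with square norm t^2 B, rescaling y by 1 + h keeps the point on the
hypersurface.  For sigma = 0 to be derived twice along the curve, h has to be
twice differentiable at 0. *)
Lemma sqrt_correction (x a : 'rV[R]_n) (B : R) : U x ->
  exists (h h1 : R -> R) (h2 : R), [/\ h 0 = 0,
    \forall t \near (0 : R), is_derive t (1 : R) h (h1 t),
    is_derive (0 : R) (1 : R) h1 h2 &
    \forall t \near (0 : R), (1 + h t) ^+ 2 * theta (sqnorm x) =
      theta (sqnorm (x + t *: a)) - t ^+ 2 * B].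
Proof.
move=> Ux; set th := theta (sqnorm x).
have th0 : 0 < th by apply: theta_gt0; exists x.
(* On points with y = 0 this function is theta(|x|^2), known to be of class
   C^2. *)
pose f : Cspace R n -> R := std_fun theta (-1).
have fC : Ck_on 2 (tube U) f by exact: std_fun_Ck2.
pose e : Cspace R n := (a, 0).
pose line (t : R) : Cspace R n := (x, 0) + t *: e.
have line0 : line 0 = (x, 0) by rewrite /line scale0r addr0.
have fl t : f (line t) = theta (sqnorm (x + t *: a)).
  rewrite /f /std_fun /= scaler0 addr0 mulN1r opprB.
  by rewrite (sqnormE 0) dot0l subr0.
have dline t : is_derive t (1 : R) line e.
  apply: (is_derive_eq (is_deriveD (is_derive_cst (x, 0 : 'rV[R]_n) t (1 : R))
    (is_derive_scalel e (is_derive_id t (1 : R))))).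
  by rewrite add0r scale1r.
have W_line : \forall t \near (0 : R), tube U (line t).
  have cc : {for 0, continuous line}.
    by apply: differentiable_continuous; apply/derivable1_diffP.
  apply: cc; rewrite line0; apply: open_nbhs_nbhs.
  by split => //; exact: tube_open.
pose F t := 'D_e f (line t).
pose q (t : R) := th^-1 * (f (line t) - t ^+ 2 * B).
pose q1 (t : R) := th^-1 * (F t - 2 * t * B).
have q0 : q 0 = 1.
  by rewrite /q fl scale0r addr0 expr0n /= mul0r subr0 mulVf ?gt_eqF.
have dq : \forall t \near (0 : R), is_derive t (1 : R) q (q1 t).
  near=> t.
  have df : differentiable f (line t).
    by case: fC => H _; apply: H; near: t.
  have H1 := is_derive_comp_curve (dline t) df.
  have Hid := is_derive_id t (1 : R).
  have H2 := is_deriveM (is_deriveM Hid Hid) (is_derive_cst B t (1 : R)).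
  apply: (is_derive_eq (is_deriveZ th^-1 (is_deriveB H1 H2))).
  rewrite /q1 /F scaler0 add0r; congr (_ * (_ - _)).
  by rewrite /GRing.scale /=; ring.
have dq1 : derivable q1 (0 : R) (1 : R).
  have dF : differentiable ('D_e f) (line 0).
    by case: fC => _ /(_ e) [H _]; apply: H; exact: nbhs_singleton W_line.
  have H1 := is_derive_comp_curve (dline 0) dF.
  have H2 := is_deriveM (is_deriveM (is_derive_cst (2 : R) (0 : R) (1 : R))
    (is_derive_id (0 : R) (1 : R))) (is_derive_cst B (0 : R) (1 : R)).
  by have [] := is_deriveZ th^-1 (is_deriveB H1 H2).
have q_gt0 : \forall t \near (0 : R), 0 < q t.
  have [dq0 _] := nbhs_singleton dq.
  have cc : {for 0, continuous q}.
    by apply: differentiable_continuous; apply/derivable1_diffP.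
  by have := @cvgr_gt _ _ _ _ _ _ cc; rewrite q0; apply.
pose h t := Num.sqrt (q t) - 1.
pose h1 t := (2 * Num.sqrt (q t))^-1 * q1 t.
have dsqrt : \forall t \near (0 : R),
    is_derive t (1 : R) (Num.sqrt \o q) (h1 t).
  near=> t.
  have qt : 0 < q t by near: t.
  have dqt : is_derive t (1 : R) q (q1 t) by near: t.
  have [sq sqE] : is_derive (q t) (1 : R) Num.sqrt (2 * Num.sqrt (q t))^-1.
    exact: is_derive1_sqrt.
  have dsq : differentiable Num.sqrt (q t) by apply/derivable1_diffP.
  apply: (is_derive_eq (is_derive_comp_curve dqt dsq)).
  have := derive_lin (0 : R) (1 : R) (q1 t) dsq.
  by rewrite add0r derive0 add0r sqE [q1 t *: _]mulr1 => ->; rewrite mulrC.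
exists h, h1, ('D_(1 : R) h1 0); split.
- by rewrite /h q0 sqrtr1 subrr.
- near=> t; have H : is_derive t (1 : R) (Num.sqrt \o q) (h1 t) by near: t.
  apply: (is_derive_eq (is_deriveB H (is_derive_cst (1 : R) t (1 : R)))).
  by rewrite subr0.
- have [ds _] := nbhs_singleton dsqrt.
  have d2 := derivableM (derivable_cst (2 : R) (0 : R) (1 : R)) ds.
  apply/derivableP; apply: (derivableM (derivableV _ d2) dq1).
  by rewrite /= !fctE q0 sqrtr1 mulr1 pnatr_eq0.
- near=> t; rewrite /h addrC subrK sqr_sqrtr; last by apply: ltW; near: t.
  by rewrite /q fl mulrC mulrA divff ?mul1r ?gt_eqF.
Unshelve. all: by end_near. Qed.

(** A direction transverse to the hypersurface, as y is not zero there. *)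
Definition vertical (p : Cspace R n) : Cspace R n := (0, p.2).

(** The kernel at p of the differential of |y|^2 - theta(|x|^2). *)
Definition real_tangent (p u : Cspace R n) : Prop :=
  dot p.2 u.2 = theta' (sqnorm p.1) * dot p.1 u.1.

Lemma Sigma_gt0 p : Sigma p -> 0 < theta (sqnorm p.1).
Proof. by move=> [Up _]; apply: theta_gt0; exists p.1. Qed.

Lemma std_grad_vertical c p : Sigma p ->
  std_grad U theta c p (vertical p) = 2 * c * theta (sqnorm p.1).
Proof.
by move=> [_ <-]; rewrite /std_grad /= (sqnormE p.2) dot0r; ring.
Qed.

(** The constant k, the second derivative of h in [sqrt_correction], depends on
p and u only: this is what makes the Levi forms of any two defining functions
comparable.  The velocity of the curve at time 0 differs from u by a multiple
of (0, y); it is u itself because the standard defining function vanishes along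
the curve and has a non-zero derivative along (0, y). *)
Lemma tangent_curve p u : Sigma p -> real_tangent p u ->
  exists k : R, forall W sigma, open W -> Ck_on 2 W sigma -> W p ->
    (forall q, W q -> Sigma q -> sigma q = 0) ->
    'D_u sigma p = 0 /\ hess sigma p u u = - (k * 'D_(vertical p) sigma p).
Proof.
move=> Sp tu; have th0 := Sigma_gt0 Sp; case: (Sp) => Up yy.
set th := theta (sqnorm p.1) in yy th0.
pose beta := dot p.2 u.2 / th.
have [b [bE yb]] : exists b, u.2 = b + beta *: p.2 /\ dot p.2 b = 0.
  exists (u.2 - beta *: p.2); rewrite subrK; split => //.
  by rewrite dotDr dotNr dotZr -sqnormE yy /beta divfK ?subrr // gt_eqF.
have [h [h1 [h2 [h0 dh dh1 hE]]]] :=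
  sqrt_correction u.1 (dot b b) Up.
pose v : Cspace R n := (u.1, b).
pose curve (t : R) : Cspace R n := p + (t *: v + h t *: vertical p).
have curveS : \forall t \near (0 : R), Sigma (curve t).
  have ct := curve_near v (vertical p) (tube_open Uo) Up h0 dh.
  near=> t; have tt : tube U (curve t) by near: t.
  have : (1 + h t) ^+ 2 * theta (sqnorm p.1) =
      theta (sqnorm (p.1 + t *: u.1)) - t ^+ 2 * dot b b by near: t.
  rewrite -/th => E; split => //; rewrite /= scaler0 addr0.
  have -> : p.2 + (t *: b + h t *: p.2) = (1 + h t) *: p.2 + t *: b.
    by rewrite scalerDl scale1r -addrA [h t *: _ + _]addrC.
  rewrite sqnormE dotDl !dotDr !dotZl !dotZr (dotC b) yb -sqnormE yy.
  by rewrite -[RHS](subrK (t ^+ 2 * dot b b)) -E; ring.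
have uE : u = v + h1 0 *: vertical p.
  have dst := std_fun_derive Uo thetaC 1 Up.
  have stdC : Ck_on 2 (tube U) (std_fun theta 1) by exact: std_fun_Ck2.
  have : 'D_(v + h1 0 *: vertical p) (std_fun theta 1) p = 0.
    apply: (curve_derive1 (tube_open Uo) stdC Up h0 dh).
    near=> t => tt; have [_ E] : Sigma (curve t) by near: t.
    by rewrite /std_fun E subrr mulr0.
  rewrite dst.2 => H.
  have {}H : h1 0 * th = beta * th.
    rewrite /beta divfK ?gt_eqF // tu; move: H.
    rewrite /std_grad /= scaler0 addr0 !dotDr !dotZr yb -sqnormE yy.
    by move=> H; lra.
  move: H => /(mulIf (lt0r_neq0 th0)) ->.
  by rewrite [LHS]surjective_pairing bE; congr pair; rewrite /= scaler0 addr0.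
exists h2 => W sigma Wo sC Wp s0.
have sF : \forall t \near (0 : R), W (curve t) -> sigma (curve t) = 0.
  by apply: filterS curveS => t St Wt; exact: s0.
rewrite {1 2 3}uE; split.
  exact: (curve_derive1 Wo sC Wp h0 dh sF).
exact: (curve_derive2 Wo sC Wp h0 dh dh1 sF).
Unshelve. all: by end_near. Qed.

Definition sublevel c : set (Cspace R n) :=
  [set p | U p.1 /\ c * (sqnorm p.2 - theta (sqnorm p.1)) < 0].

(** Twice the Levi form of |y|^2 - theta(|x|^2) at p, on complex tangent
vectors; see [std_levi]. *)
Definition levi_quad (p u : Cspace R n) : R :=
  (1 - theta' (sqnorm p.1)) * (dot u.1 u.1 + dot u.2 u.2) -
  2 * theta'' (sqnorm p.1) * (dot p.1 u.1 ^+ 2 + dot p.1 u.2 ^+ 2).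

Lemma std_hess_trace c p u :
  std_hess U theta c p u u + std_hess U theta c p (mul_i u) (mul_i u) =
  2 * c * levi_quad p u.
Proof.
by rewrite /std_hess /levi_quad /mul_i /= !dotNr !dotNl; ring.
Qed.

Section Compare.
Variables (W : set (Cspace R n)) (sigma : Cspace R n -> R) (p : Cspace R n).
Hypotheses (Wo : open W) (sC : Ck_on 2 W sigma) (Wp : W p) (Sp : Sigma p).
Hypothesis s0 : forall q, W q -> Sigma q -> sigma q = 0.

Lemma tangent_derive u : real_tangent p u -> 'D_u sigma p = 0.
Proof. by move=> /(tangent_curve Sp) [k /(_ _ _ Wo sC Wp s0) []]. Qed.

(** Elimination of the constant of [tangent_curve] between sigma and the
standard defining function, whose derivative along (0, y) is 2 theta. *)
Lemma hess_compare u : real_tangent p u ->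
  2 * theta (sqnorm p.1) * hess sigma p u u =
  'D_(vertical p) sigma p * std_hess U theta 1 p u u.
Proof.
move=> tu; have [k kP] := tangent_curve Sp tu.
have [Up yy] := Sp.
have [_ ->] := kP _ _ Wo sC Wp s0.
have stdC : Ck_on 2 (tube U) (std_fun theta 1) by exact: std_fun_Ck2.
have st0 q : tube U q -> Sigma q -> std_fun theta 1 q = 0.
  by move=> _ [_ E]; rewrite /std_fun E subrr mulr0.
have [_] := kP _ _ (tube_open Uo) stdC Up st0.
rewrite /hess (std_fun_derive2 Uo thetaC 1 u Up).2.
rewrite (std_fun_derive Uo thetaC 1 Up).2 std_grad_vertical // => ->.
by move: ('D_(vertical p) sigma p) => d; ring.
Qed.

Lemma hess_trace_compare u : real_tangent p u -> real_tangent p (mul_i u) ->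
  theta (sqnorm p.1) *
    (hess sigma p u u + hess sigma p (mul_i u) (mul_i u)) =
  'D_(vertical p) sigma p * levi_quad p u.
Proof.
move=> tu tJu; have := std_hess_trace 1 p u.
have := hess_compare tu; have := hess_compare tJu.
move: (hess sigma p u u) (hess sigma p _ _) ('D_(vertical p) sigma p).
move: (theta _) => th h h' d E E' E2.
have : d * (2 * 1 * levi_quad p u) = d * (2 * 1 * levi_quad p u) by [].
by rewrite -{1}E2 mulrDr -E -E'; move: (levi_quad p u) => q; lra.
Qed.

Lemma tangent_vertical u : exists k : R,
  real_tangent p (u - k *: vertical p).
Proof.
have th0 := Sigma_gt0 Sp; have [Up yy] := Sp.
exists ((dot p.2 u.2 - theta' (sqnorm p.1) * dot p.1 u.1) / theta (sqnorm p.1)).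
rewrite /real_tangent /= scaler0 subr0 dotDr dotNr dotZr -sqnormE yy.
by rewrite divfK ?gt_eqF // opprB addrC subrK.
Qed.

(** The differential of sigma kills the real tangent space, so it vanishes as
soon as it vanishes on the transverse direction (0, y). *)
Lemma vertical_derive_neq0 : (exists u, 'd sigma p u != 0) ->
  'D_(vertical p) sigma p != 0.
Proof.
move=> [u]; apply: contraNneq => N0.
have ds : differentiable sigma p by case: sC => H _; exact: H.
rewrite -(deriveE _ ds); have [k /tangent_derive] := tangent_vertical u.
by rewrite -scaleNr (derive_lin _ _ _ ds) N0 mulr0 addr0 => ->.
Qed.
End Compare.

(** Moving p by a small positive multiple of - c (0, y) enters the domain, where
sigma is negative. *)
Lemma vertical_derive_sign c W sigma p : c != 0 -> Sigma p ->
  defining_function (sublevel c) Sigma W sigma ->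
  0 < c * 'D_(vertical p) sigma p.
Proof.
move=> c0 Sp [[Wo SW] sC DW SE sd].
have Wp := SW _ Sp; have th0 := Sigma_gt0 Sp; have [Up yy] := Sp.
have s0 q : W q -> Sigma q -> sigma q = 0 by move=> _; rewrite SE => -[].
have ds : differentiable sigma p by case: sC => H _; exact: H.
have N0 := vertical_derive_neq0 Wo sC Wp Sp s0 (sd _ Sp).
rewrite lt0r mulf_neq0 //= -oppr_le0 -mulNr.
have <- : 'D_(- c *: vertical p) sigma p = - c * 'D_(vertical p) sigma p.
  by have := derive_lin 0 (vertical p) (- c) ds; rewrite add0r derive0 add0r.
apply: derive_le0; [exact: diff_derivable|exact: s0|].
have Wt : \forall t \near (0 : R)^'+, W (t *: (- c *: vertical p) + p).
  have lc : {for (0 : R), continuous (fun t : R => t *: (- c *: vertical p) + p)}.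
    have H := is_deriveD (is_derive_scalel (- c *: vertical p)
      (is_derive_id (0 : R) (1 : R))) (is_derive_cst p (0 : R) (1 : R)).
    by apply: differentiable_continuous; apply/derivable1_diffP; case: H.
  apply: cvg_within; apply: lc.
  by rewrite scale0r add0r; exact: open_nbhs_nbhs.
near=> t.
have t0 : 0 < t by [].
(* Scaling y by 1 - t c decreases c |y|^2 exactly when 0 < t c^2 (2 - t c). *)
have tc : t * c < 2.
  have : t < 2 / `|c|.
    by near: t; apply: nbhs_right_lt; rewrite divr_gt0 ?normr_gt0.
  rewrite ltr_pdivlMr ?normr_gt0 //; apply: le_lt_trans.
  exact: ler_wpM2l (ltW t0) _ _ (ler_norm c).
have : W (t *: (- c *: vertical p) + p) by near: t.
set q := t *: _ + p => Wq.
suff Dq : sublevel c q.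
  have : (sublevel c `&` W) q by [].
  by rewrite DW => -[_ /ltW].
split; rewrite /q /= scaler0 scaler0 add0r //.
have -> : t *: (- c *: p.2) + p.2 = (1 - t * c) *: p.2.
  by rewrite scalerA scalerBl scale1r addrC mulrN scaleNr.
rewrite sqnormE dotZl dotZr -sqnormE yy.
set th := theta (sqnorm p.1).
have -> : c * ((1 - t * c) * ((1 - t * c) * th) - th) =
  (t * c ^+ 2 * th) * (t * c - 2) by ring.
have c2 : 0 < c ^+ 2 by rewrite exprn_even_gt0.
by rewrite pmulr_rlt0 ?subr_lt0 // mulr_gt0 // mulr_gt0.
Unshelve. all: by end_near. Qed.

Lemma std_defining c : c != 0 ->
  defining_function (sublevel c) Sigma (tube U) (std_fun theta c).
Proof.
move=> c0; split.
- by split; [exact: tube_open|move=> p []].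
- exact: std_fun_Ck2.
- by apply/seteqP; split=> p /= [] => [[]|].
- apply/seteqP; split=> p /= [Up].
    by move=> E; split => //; rewrite /std_fun E subrr mulr0.
  by rewrite /std_fun => /eqP; rewrite mulf_eq0 (negPf c0) subr_eq0 => /eqP.
- move=> p Sp; exists (vertical p); have [Up _] := Sp.
  have [ds D] := std_fun_derive Uo thetaC c Up.
  rewrite -(deriveE _ ds) D std_grad_vertical // !mulf_neq0 ?pnatr_eq0 //.
  by rewrite gt_eqF // Sigma_gt0.
Qed.

(** P stands for strict or weak positivity.  That u and iu are both real tangent means
that u is complex tangent. *)
Definition levi_condition (P : R -> Prop) c := forall p, Sigma p -> forall u,
  u != 0 -> real_tangent p u -> real_tangent p (mul_i u) ->
  P (c * levi_quad p u).

Lemma levi_condition_of_strong c : c != 0 ->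
  strongly_pseudoconvex_along (sublevel c) Sigma ->
  levi_condition (fun q => 0 < q) c.
Proof.
move=> c0 [W [sigma [Hdef H]]] p Sp u u0 tu tJu.
have [[Wo SW] sC DW SE sd] := Hdef.
have Wp := SW _ Sp; have th0 := Sigma_gt0 Sp.
have s0 q : W q -> Sigma q -> sigma q = 0 by move=> _; rewrite SE => -[].
pose v : 'rV[R[i]]_n := \row_j (u.1 0 j +i* u.2 0 j)%C.
have vu : real_vec v = u.
  by rewrite [RHS]surjective_pairing; congr pair; apply/rowP => j; rewrite !mxE.
have v0 : v != 0.
  apply: contraNneq u0 => v0; rewrite -vu v0; apply/eqP.
  transitivity ((0, 0) : Cspace R n) => //.
  by congr pair; apply/rowP => j; rewrite !mxE.
have tv : complex_tangent sigma p v.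
  apply/(complex_tangentE sC _ Wp); rewrite vu.
  by split; exact: (tangent_derive Wo sC Wp Sp s0).
have N := vertical_derive_sign c0 Sp Hdef.
have := H p Sp v tv v0; rewrite (levi_formE Wo sC _ Wp) vu ltcE /= => /andP[_].
rewrite pmulr_lgt0 ?invr_gt0 // => T0.
have := hess_trace_compare Wo sC Wp Sp s0 tu tJu.
move: T0 N; move: (_ + _) ('D_(vertical p) sigma p) (levi_quad p u) => T d q.
move=> T0 cd E; rewrite -(pmulr_rgt0 _ cd) mulrACA -E.
have c2 : 0 < c * c by rewrite -expr2 exprn_even_gt0.
by rewrite mulr_gt0 // mulr_gt0.
Qed.

Lemma std_levi c p v : c != 0 -> Sigma p ->
  complex_tangent (std_fun theta c) p v ->
  [/\ real_tangent p (real_vec v), real_tangent p (mul_i (real_vec v)) &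
   levi_form (std_fun theta c) p v = (c * levi_quad p (real_vec v) / 2)%:C%C].
Proof.
move=> c0 Sp; have [Up _] := Sp.
have stdC : Ck_on 2 (tube U) (std_fun theta c) by exact: std_fun_Ck2.
move=> /(complex_tangentE stdC _ Up).
rewrite !(std_fun_derive Uo thetaC c Up).2.
have gt u : std_grad U theta c p u = 0 -> real_tangent p u.
  rewrite /std_grad /real_tangent => /eqP; rewrite mulf_eq0 (negPf c0) /=.
  by move=> /eqP H; lra.
move=> [/gt tu /gt tJu]; split => //.
have hE a b : hess (std_fun theta c) p a b = std_hess U theta c p a b.
  by have [_ E] := std_fun_derive2 Uo thetaC c b Up; exact: E.
rewrite (levi_formE (tube_open Uo) stdC _ Up) !hE std_hess_trace.
apply/eqP; rewrite eq_complex /=; apply/andP; split; apply/eqP.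
  by move: (levi_quad _ _) => q; field.
by rewrite /std_hess /mul_i /= !dotNr !dotNl (dotC (real_vec v).1); ring.
Qed.

Lemma real_vec_neq0 (v : 'rV[R[i]]_n) : v != 0 -> real_vec v != 0.
Proof.
apply: contraNneq => E; apply/eqP/rowP => j; apply/eqP; rewrite eq_complex mxE.
have /rowP/(_ j) : (real_vec v).1 = 0 by rewrite E.
have /rowP/(_ j) : (real_vec v).2 = 0 by rewrite E.
by rewrite !mxE => -> ->; rewrite eqxx.
Qed.

Lemma strong_of_levi_condition c : c != 0 -> levi_condition (fun q => 0 < q) c ->
  strongly_pseudoconvex_along (sublevel c) Sigma.
Proof.
move=> c0 H; exists (tube U), (std_fun theta c).
split=> [|p Sp v tv v0]; first exact: std_defining.
have [tu tJu ->] := std_levi c0 Sp tv.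
by rewrite ltcE /= eqxx divr_gt0 //; apply: H => //; exact: real_vec_neq0.
Qed.

Lemma weak_of_levi_condition c : c != 0 -> levi_condition (fun q => 0 <= q) c ->
  weakly_pseudoconvex_along (sublevel c) Sigma.
Proof.
move=> c0 H; exists (tube U), (std_fun theta c).
split=> [|p Sp v tv v0]; first exact: std_defining.
have [tu tJu ->] := std_levi c0 Sp tv.
by rewrite lecE /= eqxx divr_ge0 //; apply: H => //; exact: real_vec_neq0.
Qed.

(** The two conclusions come from the vectors at which (x.a)^2 + (x.b)^2 is
extremal: zero for a real vector orthogonal to parallel x and y, and maximal
for (theta x, theta' r y) when x and y are orthogonal. *)
Lemma levi_condition_tests c x : (1 < n)%N -> U x ->
  levi_condition (fun q => 0 < q) c ->
  let r := sqnorm x in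
  0 < c * (1 - theta' r) /\
  0 < c * ((1 - theta' r) * (r * theta' r ^+ 2 + theta r)
           - 2 * r * theta r * theta'' r).
Proof.
move=> n1 Ux H r.
have th0 : 0 < theta r by apply: theta_gt0; exists x.
have first : 0 < c * (1 - theta' r).
  (* When x = 0, any direction e can serve as that of y. *)
  have [e [s [e0 xE]]] : exists (e : 'rV[R]_n) (s : R), e != 0 /\ x = s *: e.
    have [x0|x0] := eqVneq x 0.
      have [e e0 _] := exists_orthogonal (0 : 'rV[R]_n) n1.
      by exists e, 0; rewrite scale0r.
    by exists x, 1; rewrite scale1r.
  have [v v0 ev] := exists_orthogonal e n1.
  have [k kE] := exists_scaled e0 (ltW th0).
  have xv : dot x v = 0 by rewrite xE dotZl ev mulr0.
  have yv : dot (k *: e) v = 0 by rewrite dotZl ev mulr0.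
  have : 0 < c * levi_quad (x, k *: e) (v, 0).
    apply: H; rewrite /real_tangent /mul_i /= ?dot0r ?xv ?yv ?oppr0 ?dot0r ?mulr0 //.
    by apply: contraNneq v0 => -[->].
  rewrite /levi_quad /= xv !dot0r expr0n /= !addr0 mulr0 subr0 mulrA -/r.
  by rewrite pmulr_lgt0 // dot_gt0.
(* For x = 0 the maximal vector degenerates, but r = 0 reduces the second
   inequality to the first. *)
split=> //; have [x0|x0] := eqVneq x 0.
  have r0 : r = 0 by rewrite /r x0 sqnormE dot0l.
  move: first; rewrite r0; have := th0; rewrite r0 => th0'.
  rewrite !mulr0 !mul0r subr0 add0r mulrA => h.
  by rewrite mulr_gt0.
have [v v0 xv] := exists_orthogonal x n1.
have [k kE] := exists_scaled v0 (ltW th0).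
have [y [xy yE]] : exists y, dot x y = 0 /\ dot y y = theta r.
  by exists (k *: v); rewrite -sqnormE kE dotZr xv mulr0.
have r0 : 0 < r by rewrite /r sqnormE dot_gt0.
have rE : dot x x = r by rewrite /r sqnormE.
have : 0 < c * levi_quad (x, y) (theta r *: x, (theta' r * r) *: y).
  apply: H.
  - by split=> //; rewrite sqnormE.
  - apply: contraNneq x0 => -[/eqP].
    by rewrite scaler_eq0 gt_eqF //= => /eqP ->.
  - by rewrite /real_tangent /= -/r !dotZr rE yE; ring.
  - by rewrite /real_tangent /mul_i /= -/r dotNr !dotZr xy dotC xy; ring.
rewrite /levi_quad /= -/r !(dotZl, dotZr) xy rE yE => h.
rewrite -(pmulr_rgt0 _ (mulr_gt0 r0 th0)).
by apply: (lt_le_trans h); rewrite le_eqVlt; apply/orP; left; apply/eqP; ring.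
Qed.

(** N times the Levi form is affine in (x.a)^2 + (x.b)^2, so that it is bounded
below by one of its values at the two ends of the range of this quantity,
according to the sign of c theta''. *)
Lemma levi_quad_bound c p u : Sigma p -> u != 0 ->
  real_tangent p u -> real_tangent p (mul_i u) ->
  let r := sqnorm p.1 in let N := r * theta' r ^+ 2 + theta r in
  exists S, [/\ 0 < N, 0 < S &
    c * (1 - theta' r) * N * S <= N * (c * levi_quad p u) \/
    c * ((1 - theta' r) * N - 2 * r * theta r * theta'' r) * S
      <= N * (c * levi_quad p u)].
Proof.
move=> Sp u0 tu tJu r N; have th0 : 0 < theta r by exact: Sigma_gt0.
have [Up yy] := Sp.
have r0 : 0 <= r by rewrite /r sqnormE dot_ge0.
have N0 : 0 < N by rewrite ltr_wpDl // mulr_ge0 // sqr_ge0.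
set S := dot u.1 u.1 + dot u.2 u.2.
have S0 : 0 < S.
  have [u1|u1] := eqVneq u.1 0; last by rewrite ltr_wpDr ?dot_ge0 ?dot_gt0.
  rewrite ltr_wpDl ?dot_ge0 // dot_gt0 //.
  by apply: contraNneq u0 => u2; rewrite [u]surjective_pairing u1 u2.
have Q := tangent_bessel (x := p.1) (y := p.2) (m := theta' r) tu.
rewrite -!sqnormE yy -/r in Q.
have {}Q : N * (dot p.1 u.1 ^+ 2 + dot p.1 u.2 ^+ 2) <= r * theta r * S.
  apply: Q => //; move: tJu; rewrite /real_tangent /mul_i /= => ->.
  by rewrite dotNr mulrN.
exists S; split=> //; rewrite /levi_quad -/r -/S.
move: Q; set q := (_ ^+ 2 + _ ^+ 2) => Q.
have q0 : 0 <= q by rewrite addr_ge0 ?sqr_ge0.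
have [t0|t0] := lerP (c * theta'' r) 0; [left|right]; rewrite -subr_ge0.
  have -> : N * (c * ((1 - theta' r) * S - 2 * theta'' r * q)) -
     c * (1 - theta' r) * N * S = N * q * 2 * - (c * theta'' r) by ring.
  by rewrite mulr_ge0 ?oppr_ge0 // mulr_ge0 // mulr_ge0 // ltW.
have -> : N * (c * ((1 - theta' r) * S - 2 * theta'' r * q)) -
   c * ((1 - theta' r) * N - 2 * r * theta r * theta'' r) * S =
   (r * theta r * S - N * q) * 2 * (c * theta'' r) by ring.
by rewrite mulr_ge0 ?(ltW t0) // mulr_ge0 // subr_ge0.
Qed.

Lemma strongly_pseudoconvexP c : (1 < n)%N -> c != 0 ->
  strongly_pseudoconvex_along (sublevel c) Sigma <->
  forall x, U x -> let r := sqnorm x in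
    0 < c * (1 - theta' r) /\
    0 < c * ((1 - theta' r) * (r * theta' r ^+ 2 + theta r)
             - 2 * r * theta r * theta'' r).
Proof.
move=> n1 c0; split=> [/(levi_condition_of_strong c0) H x Ux|H].
  exact: levi_condition_tests.
apply: strong_of_levi_condition => // p Sp u u0 tu tJu.
have [S [N0 S0 [] B]] := levi_quad_bound c Sp u0 tu tJu;
  have [Up _] := Sp; have [H1 H2] := H _ Up;
  rewrite -(pmulr_rgt0 _ N0); apply: lt_le_trans B.
- by rewrite mulr_gt0 // mulr_gt0.
- by rewrite mulr_gt0.
Qed.

Lemma weakly_pseudoconvex_of_ode c : c != 0 ->
  (forall x, U x -> let r := sqnorm x in
     2 * r * theta r * theta'' r
     = (1 - theta' r) * (r * theta' r ^+ 2 + theta r)) ->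
  (forall x, U x -> 0 < c * (1 - theta' (sqnorm x))) ->
  weakly_pseudoconvex_along (sublevel c) Sigma.
Proof.
move=> c0 E H; apply: weak_of_levi_condition => // p Sp u u0 tu tJu.
have [S [N0 S0 [] B]] := levi_quad_bound c Sp u0 tu tJu;
  have [Up _] := Sp; rewrite -(pmulr_rge0 _ N0); apply: le_trans B.
- by rewrite mulr_ge0 ?(ltW S0) // mulr_ge0 ?(ltW N0) // ltW // H.
- by rewrite E // subrr mulr0 mul0r.
Qed.

End Hypersurface.

Lemma domain_minusE (R : realType) (n : nat) (U : set 'rV[R]_n)
    (theta : R -> R) :
  domain_minus U theta = sublevel U theta 1.
Proof.
by apply/seteqP; split=> p [Up h]; split=> //; move: h;
  rewrite mul1r subr_lt0.
Qed.

Lemma domain_plusE (R : realType) (n : nat) (U : set 'rV[R]_n)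
    (theta : R -> R) :
  domain_plus U theta = sublevel U theta (-1).
Proof.
by apply/seteqP; split=> p [Up h]; split=> //; move: h;
  rewrite mulN1r oppr_lt0 subr_gt0.
Qed.

Theorem proposition2p1 (R : realType) (n : nat) (U : set 'rV[R]_n)
    (theta : R -> R) :
  (1 < n)%N -> open U -> U !=set0 -> On_invariant U ->
  let I : set R := [set sqnorm x | x in U] in
  (forall t, I t -> 0 < theta t) ->
  Ck_within 2 I theta ->
  let theta' : R -> R := derive_within I theta in
  let theta'' : R -> R := derive_within I theta' in
  [/\ strongly_pseudoconvex_along (domain_minus U theta) (hypersurface U theta)
      <-> (forall x, U x -> let r := sqnorm x in
             theta' r < 1 /\
             2 * r * theta r * theta'' r
               < (1 - theta' r) * (r * theta' r ^+ 2 + theta r)),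
      strongly_pseudoconvex_along (domain_plus U theta) (hypersurface U theta)
      <-> (forall x, U x -> let r := sqnorm x in
             theta' r > 1 /\
             2 * r * theta r * theta'' r
               > (1 - theta' r) * (r * theta' r ^+ 2 + theta r)) &
      (forall x, U x -> let r := sqnorm x in
         2 * r * theta r * theta'' r
           = (1 - theta' r) * (r * theta' r ^+ 2 + theta r)) ->
      ((forall t, I t -> theta' t < 1) ->
         weakly_pseudoconvex_along (domain_minus U theta)
           (hypersurface U theta)) /\
      ((forall t, I t -> theta' t > 1) ->
         weakly_pseudoconvex_along (domain_plus U theta)
           (hypersurface U theta))].
Proof.
move=> n1 Uo _ _ I theta_gt0 thetaC theta' theta''.
have N1 : (-1 : R) != 0 by rewrite oppr_eq0 oner_neq0.
rewrite domain_minusE domain_plusE; split.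
- split=> [/(strongly_pseudoconvexP Uo thetaC theta_gt0 n1 (oner_neq0 R)) H|H].
    by move=> x Ux r; have := H x Ux; rewrite /= !mul1r !subr_gt0.
  apply/(strongly_pseudoconvexP Uo thetaC theta_gt0 n1 (oner_neq0 R)) => x Ux r.
  by have := H x Ux; rewrite /= !mul1r !subr_gt0.
- split=> [/(strongly_pseudoconvexP Uo thetaC theta_gt0 n1 N1) H|H].
    by move=> x Ux r; have := H x Ux; rewrite /= !mulN1r !oppr_gt0 !subr_lt0.
  apply/(strongly_pseudoconvexP Uo thetaC theta_gt0 n1 N1) => x Ux r.
  by have := H x Ux; rewrite /= !mulN1r !oppr_gt0 !subr_lt0.
- move=> E; split=> H.
    apply: (weakly_pseudoconvex_of_ode Uo thetaC theta_gt0 (oner_neq0 R) E).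
    by move=> x Ux; rewrite mul1r subr_gt0; apply: H; exists x.
  apply: (weakly_pseudoconvex_of_ode Uo thetaC theta_gt0 N1 E) => x Ux.
  by rewrite mulN1r oppr_gt0 subr_lt0; apply: H; exists x.
Qed.
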